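(* Let $n\geqslant 2$ be an integer. For a pair of bidirectional carousels operated under the ''go to the nearest item'' (single direction) strategy, the distribution function $F_S$ of the steady-state sojourn time $S$ of the picker satisfies, for $0\leqslant x\leqslant 1$, the integral equation $$F_S(x)=nx^{n-1}-(n-1)x^n-2n(n-1)\int_{(2x-1)^+}^{x}y^{n-2}\int_{0}^{\frac{1}{2}+\frac{y}{2}-x}F_S(z)\,dz\,dy.$$
   Context: Model. A carousel is a circle of length $1$ rotating at unit speed. Each order consists of $n$ items whose positions are independent and uniformly distributed on the circle. One picker alternates between two carousels, picking one order at each visit; switching and item-removal times are ignored. For an order, the preparation time $B$ is the rotation time from the carousel's current position (the origin) to the first item to be picked, and the pick (travel) time $A$ is the rotation time needed, after the first item is reached, to visit the remaining $n-1$ items. Strategy considered. The carousel moves to the item nearest to the origin (in either direction), so $B$ is the distance to the nearest item, and then continues rotating in that same direction to collect the rest of the order, so $A$ is the distance, in that direction, from the nearest item to the last of the remaining items. (Thus $A$ has density $n(n-1)(1-y)y^{n-2}$ on $(0,1)$, and given $A=y$, $B$ is uniform on $[0,\frac{1-y}{2}]$.) Sojourn time. The sojourn times of successive orders satisfy $S_{k+1}=(B_{k+1}-S_k)^++A_{k+1}$, $S_1=B_1+A_1$, where the pairs $(A_k,B_k)$ are i.i.d. copies of $(A,B)$ and $u^+=\max\{0,u\}$. $S$ is distributed according to the (unique) limiting distribution of $S_k$ as $k\to\infty$, so that $S\stackrel{\mathcal{D}}{=}(B-S)^++A$ with $S$ on the right-hand side independent of $(A,B)$. It is assumed that $0\leqslant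 S\leqslant 1$ (so $F_S(1)=1$), $F_S(0)=0$ and that $S$ has a density. *)

(* Defs.v *)
From HB Require Import structures.
From mathcomp Require Import all_boot all_order all_algebra.
From mathcomp Require Import all_classical all_reals all_analysis.

Set Implicit Arguments.
Unset Strict Implicit.
Unset Printing Implicit Defensive.

Import Order.TTheory GRing.Theory Num.Theory.
Import numFieldNormedType.Exports.

Local Open Scope classical_set_scope.
Local Open Scope ring_scope.

(* The circle of length 1 is [0, 1] with endpoints identified; [p i] is the
   position of the i-th item of an order, measured clockwise from the point
   the carousel currently presents to the picker (the origin). *)
Section Carousel.
Context {R : realType} {n : nat}.
Implicit Type p : 'I_n -> R.

(* Rotation time from the origin to the point [x], counterclockwise if [ccw]
   and clockwise otherwise. *)
Definition travel (ccw : bool) (x : R) : R := if ccw then 1 - x else x.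

(* The default value 1 of the minimum, an upper bound on every distance, only
   matters for an empty order. *)
Definition first_item (ccw : bool) p : R :=
  \big[Num.min/1]_(i < n) travel ccw (p i).

(* Likewise for the default value 0. *)
Definition last_item (ccw : bool) p : R :=
  \big[Num.max/0]_(i < n) travel ccw (p i).

(* B *)
Definition prep_time p : R :=
  \big[Num.min/1]_(i < n) Num.min (travel false (p i)) (travel true (p i)).

(* Whether the nearest item lies counterclockwise; a tie, which has
   probability 0 for uniform positions, is resolved clockwise. *)
Definition nearest_ccw p : bool := first_item true p < first_item false p.

(* A: the carousel keeps rotating in the direction of the nearest item, which
   is the first item it meets in that direction. *)
Definition pick_time p : R :=
  last_item (nearest_ccw p) p - first_item (nearest_ccw p) p.

End Carousel.

Section RandomVariables.
Context {R : realType}.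

Definition uniform01 d (T : measurableType d) (P : probability T R)
    (X : {RV P >-> R}) : Prop :=
  forall D : set R, measurable D ->
    distribution P X D = uniform_prob (@ltr01 R) D.

Definition mutually_independent d (T : measurableType d) (P : probability T R)
    (I : eqType) (X : I -> {RV P >-> R}) : Prop :=
  forall (s : seq I) (D : I -> set R), uniq s -> (forall i, measurable (D i)) ->
    P (\bigcap_(i in [set` s]) (X i @^-1` D i)) =
    (\prod_(i <- s) P (X i @^-1` D i))%E.

(* The limit need not live on the same probability space as the sequence. *)
Definition cvg_in_distribution d (T : measurableType d) (P : probability T R)
    d' (T' : measurableType d') (P' : probability T' R)
    (X_ : nat -> {RV P >-> R}) (X : {RV P' >-> R}) : Prop :=
  forall x : R, {for x, continuous (cdf X)} ->
    cdf (X_ k) x @[k --> \oo] --> cdf X x.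

Definition has_density d (T : measurableType d) (P : probability T R)
    (X : {RV P >-> R}) : Prop :=
  exists f : R -> R, [/\ measurable_fun setT f, forall t, 0 <= f t &
    forall D : set R, measurable D ->
      distribution P X D = (\int[lebesgue_measure]_(t in D) (f t)%:E)%E].

Definition dist_fun d (T : measurableType d) (P : probability T R)
    (X : {RV P >-> R}) (x : R) : R := fine (cdf X x).

End RandomVariables.

(* [pos k i] is the position of the i-th item of the k-th order and [S_ k] the
   sojourn time of that order; orders are numbered from 0. *)
Definition sojourn_process {R : realType} {n d} {T : measurableType d}
    {P : probability T R}
    (pos : nat -> 'I_n -> {RV P >-> R}) (S_ : nat -> {RV P >-> R}) : Prop :=
  let A k w := pick_time (fun i => pos k i w) in
  let B k w := prep_time (fun i => pos k i w) in
  (forall w, S_ 0%N w = B 0%N w + A 0%N w) /\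
  (forall k w, S_ k.+1 w = Num.max 0 (B k.+1 w - S_ k w) + A k.+1 w).

(* Main.v *)
(* Conditionally on S_k = s, the event S_(k+1) <= x only depends on the n fresh
   positions. It splits, up to the null event of ties, into 2n disjoint events
   saying that item i is nearest in a given direction, at distance b, and that
   the other items lie in the arc ]b, min(1 - b, x + min(b, s))]. Such an event
   has probability \int_b (arc length)^(n-1) db, and writing the (n-1)-st power
   as an integral over a in ]0, arc length[ exhibits the joint density of (B, A).
   That ties are negligible needs no separate argument: for x = s = 1 the 2n
   probabilities add up to 1.
   Integrating over s, with S_k independent of the fresh positions, expresses
   the distribution function of S_(k+1) through that of S_k, and dominated
   convergence passes to the limit, which is continuous as S has a density. *)
Require Import Defs.
From HB Require Import structures.
From mathcomp Require Import all_boot all_order all_algebra.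
From mathcomp Require Import all_classical all_reals all_analysis.
From mathcomp Require Import measurable_realfun ring lra.

Set Implicit Arguments.
Unset Strict Implicit.
Unset Printing Implicit Defensive.

Import Order.TTheory GRing.Theory Num.Theory.
Import numFieldNormedType.Exports.

Local Open Scope classical_set_scope.
Local Open Scope ring_scope.

(** * Independence of generated sigma-algebras, and freezing one of two independent arguments *)

Section independence.
Local Open Scope ereal_scope.
Context d (T : measurableType d) (R : realType) (P : probability T R).

(** Both sides are finite measures in [A], a restriction and a multiple of [P]; they agree on the
    pi-system [G], hence on the sigma-algebra it generates. *)
Lemma indep_g_sigma_algebral (G : set (set T)) (B : set T) :
    G `<=` measurable -> setI_closed G -> G setT -> measurable B ->
    (forall A, G A -> P (A `&` B) = P A * P B) ->
  forall A, <<s G >> A -> P (A `&` B) = P A * P B.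
Proof.
move=> Gm GI GT mB GB A GA.
have PBfin : P B \is a fin_num by rewrite fin_num_measure.
have PB0 : (0 <= fine (P B))%R by rewrite fine_ge0.
pose c : {nonneg R} := NngNum PB0.
have -> : P A * P B = mscale c P A by rewrite /mscale/= fineK// muleC.
apply: (@g_sigma_algebra_measure_unique _ _ _ G Gm (fun=> setT) _ _
  (mrestr P mB) (mscale c P)) => //.
- by rewrite bigcup_const//; exists 0%N.
- by move=> C GC; rewrite /= /mrestr /mscale/= GB// fineK// muleC.
- by move=> _; rewrite /= /mrestr setTI -ge0_fin_numE.
Qed.

Lemma indep_g_sigma_algebra (G1 G2 : set (set T)) :
    G1 `<=` measurable -> G2 `<=` measurable ->
    setI_closed G1 -> setI_closed G2 -> G1 setT -> G2 setT ->
    (forall A B, G1 A -> G2 B -> P (A `&` B) = P A * P B) ->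
  forall A B, <<s G1 >> A -> <<s G2 >> B -> P (A `&` B) = P A * P B.
Proof.
move=> G1m G2m G1I G2I G1T G2T G12 A B sA sB.
have mB : measurable B.
  exact: (smallest_sub (@sigma_algebra_measurable _ T) G2m).
apply: (indep_g_sigma_algebral G1m) => // A' GA'.
rewrite setIC muleC; apply: (indep_g_sigma_algebral G2m) => //.
  exact: G1m.
by move=> B' GB'; rewrite setIC muleC G12.
Qed.

(** Plays the role of conditioning. By independence the diagonal map sends [P] to a product measure
    on the two sigma-algebras, and the product measure of [E] is the integral of the measures of its
    sections. *)
Lemma decoupling (G1 G2 : set (set T)) :
    G1 `<=` measurable -> G2 `<=` measurable ->
    setI_closed G1 -> setI_closed G2 -> G1 setT -> G2 setT ->
    (forall A B, G1 A -> G2 B -> P (A `&` B) = P A * P B) ->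
  forall E : set (g_sigma_algebraType G1 * g_sigma_algebraType G2),
    measurable E ->
  P [set w | E (w, w)] = \int[P]_w P [set w' | E (w, w')].
Proof.
move=> G1m G2m G1I G2I G1T G2T G12 E mE.
set T1 := g_sigma_algebraType G1 in E mE *.
set T2 := g_sigma_algebraType G2 in E mE *.
have m1 : measurable_fun setT (id : T -> T1).
  move=> _ A mA; rewrite setTI preimage_id.
  exact: (smallest_sub (@sigma_algebra_measurable _ T) G1m).
have m2 : measurable_fun setT (id : T -> T2).
  move=> _ A mA; rewrite setTI preimage_id.
  exact: (smallest_sub (@sigma_algebra_measurable _ T) G2m).
have m12 : measurable_fun setT ((fun w => (w, w)) : T -> (T1 * T2)%type).
  exact: measurable_fun_pair.
pose X1 : {mfun T >-> T1} := mfun_Sub (mem_set m1).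
pose X2 : {mfun T >-> T2} := mfun_Sub (mem_set m2).
pose X12 : {mfun T >-> (T1 * T2)%type} := mfun_Sub (mem_set m12).
transitivity (distribution P X12 E) => //.
rewrite -(@product_measure_unique _ _ _ _ _ (distribution P X1)
  (distribution P X2))//; last first.
  by move=> A B mA mB; exact: (indep_g_sigma_algebra G1m G2m).
rewrite /product_measure1 ge0_integral_pushforward//=; last first.
  exact: measurable_fun_xsection.
apply: eq_integral => w _; congr (P _).
by apply/seteqP; split => w' /=; rewrite /xsection/= /preimage/= inE.
Qed.

End independence.

(** * Finite-dimensional events of a family of random variables *)

Section cylinders.
Local Open Scope ereal_scope.
Context d (T : measurableType d) (R : realType) (P : probability T R).
Context (I : eqType) (X : I -> {RV P >-> R}).
Implicit Types J : pred I.

(** A pi-system generating the sigma-algebra of the variables with index in [J]. *)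
Definition cylinders J : set (set T) :=
  [set C | exists (s : seq I) (D : I -> set R),
    [/\ uniq s, all J s, forall i, measurable (D i) &
        C = \bigcap_(i in [set` s]) (X i @^-1` D i)]].

Lemma cylinders_measurable J : cylinders J `<=` measurable.
Proof.
move=> _ [s [D [_ _ mD ->]]]; apply: fin_bigcap_measurable => // i _.
exact: measurable_funPTI.
Qed.

Lemma cylindersT J : cylinders J setT.
Proof.
exists [::], (fun=> setT); split => //.
by rewrite set_nil bigcap_set0.
Qed.

Lemma cylindersI J : setI_closed (cylinders J).
Proof.
move=> _ _ [s [D [us Js mD ->]]] [t [E [ut Jt mE ->]]].
(* [D] and [E] are total families: an index absent from one list must not be constrained by the
   corresponding family, hence the default [setT]. *)
pose DE i := (if i \in s then D i else setT) `&` (if i \in t then E i else setT).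
exists (undup (s ++ t)), DE; split => //.
- exact: undup_uniq.
- apply/allP => i; rewrite mem_undup mem_cat => /orP[].
    by move/allP : Js; exact.
  by move/allP : Jt; exact.
- by move=> i; rewrite /DE; apply: measurableI; case: ifPn.
- apply/seteqP; split => w.
    move=> [Dw Ew] i /= _; split; case: ifPn => // ?; [exact: Dw|exact: Ew].
  move=> /= DEw; split=> i /= si.
    have /DEw[] : [set` undup (s ++ t)] i by rewrite /= mem_undup mem_cat si.
    by rewrite si.
  have /DEw[] : [set` undup (s ++ t)] i by rewrite /= mem_undup mem_cat si orbT.
  by rewrite si.
Qed.

Lemma cylinders_indep J1 J2 : mutually_independent X ->
    (forall i, ~~ (J1 i && J2 i)) ->
  forall A B, cylinders J1 A -> cylinders J2 B -> P (A `&` B) = P A * P B.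
Proof.
move=> iX J12 _ _ [s [D [us Js mD ->]]] [t [E [ut Jt mE ->]]].
(* Since [J1] and [J2] are disjoint, one family of sets serves both lists, and mutual independence
   applies to their concatenation. *)
pose DE i := if J1 i then D i else E i.
have sE i : i \in s -> DE i = D i.
  by move=> si; rewrite /DE; move/allP : Js => /(_ _ si) ->.
have tE i : i \in t -> DE i = E i.
  move=> ti; rewrite /DE; move/allP : Jt => /(_ _ ti) J2i.
  by move: (J12 i); rewrite J2i andbT => /negbTE ->.
have -> : (\bigcap_(i in [set` s]) (X i @^-1` D i)) `&`
    (\bigcap_(i in [set` t]) (X i @^-1` E i)) =
    \bigcap_(i in [set` s ++ t]) (X i @^-1` DE i).
  apply/seteqP; split => w.
    move=> [Dw Ew] i /=; rewrite mem_cat => /orP[] si.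
      by rewrite sE//; exact: Dw.
    by rewrite tE//; exact: Ew.
  move=> DEw; split => i /= si.
    by rewrite -sE//; apply: DEw => /=; rewrite mem_cat si.
  by rewrite -tE//; apply: DEw => /=; rewrite mem_cat si orbT.
rewrite iX; last 2 first.
- rewrite cat_uniq us ut andbT/=; apply/hasPn => i ti; apply/negP => si.
  move/allP : Js => /(_ _ si) J1i; move/allP : Jt => /(_ _ ti) J2i.
  by move: (J12 i); rewrite J1i J2i.
- by move=> i; rewrite /DE; case: ifPn.
rewrite big_cat/= !iX//; congr (_ * _); apply: eq_big_seq => i si.
  by rewrite sE.
by rewrite tE.
Qed.

Lemma measurable_cylinders J i : J i ->
  measurable_fun [set: g_sigma_algebraType (cylinders J)] (X i).
Proof.
move=> Ji _ A mA; rewrite setTI; apply: sub_sigma_algebra.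
exists [:: i], (fun=> A); split => //=; first by rewrite Ji.
apply/seteqP; split => w /= Aw; last by apply: Aw => /=; rewrite inE.
by move=> j /=; rewrite inE => /eqP ->.
Qed.

Lemma cylinders_decoupling J1 J2 : mutually_independent X ->
    (forall i, ~~ (J1 i && J2 i)) ->
  forall E : set (g_sigma_algebraType (cylinders J1) *
                  g_sigma_algebraType (cylinders J2)),
    measurable E ->
  P [set w | E (w, w)] = \int[P]_w P [set w' | E (w, w')].
Proof.
move=> iX J12; apply: decoupling.
- exact: cylinders_measurable.
- exact: cylinders_measurable.
- exact: cylindersI.
- exact: cylindersI.
- exact: cylindersT.
- exact: cylindersT.
- exact: cylinders_indep.
Qed.

End cylinders.

(** * The joint density of preparation and pick times *)

Section density.
Local Open Scope ereal_scope.
Context {R : realType}.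
Notation mu := lebesgue_measure.

(** Turns the power of an arc length into an integral over the pick time; the maximum with 0 covers
    an empty range. *)
Lemma integral_pow_itv (m : nat) (c : R) :
  \int[mu]_y (if (0 <= y < c)%R then m.+1%:R * y ^+ m else 0)%:E =
  (Num.max 0 c ^+ m.+1)%:E.
Proof.
transitivity (\int[mu]_(y in `[0%R, c[) (m.+1%:R * y ^+ m)%:E).
  rewrite [RHS]integral_mkcond; apply: eq_integral => y _.
  by rewrite patchE mem_setE in_itv/=; case: ifPn.
have [c0|c0] := leP c 0%R.
  by rewrite set_itv_ge ?bnd_simp -?leNgt// integral_set0 expr0n.
rewrite integral_itv_bndo_bndc; last first.
  by apply/measurable_EFinP; exact: measurable_funM.
rewrite (@continuous_FTC2 _ _ (fun y => y ^+ m.+1)%R)//.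
- by rewrite expr0n/= sube0.
- apply: continuous_subspaceT => y.
  by apply: cvgM; [exact: cvg_cst|exact: exprn_continuous].
- split.
  + by move=> y _; exact: exprn_derivable.
  + by apply: cvg_at_right_filter; exact: exprn_continuous.
  + by apply: cvg_at_left_filter; exact: exprn_continuous.
- by move=> y _; rewrite exp_derive1.
Qed.

(* Up to the factor [2 * m.+2], the joint density of the pair (B, A) of an
   order of [m.+2] items, restricted to [A < x]. *)
Definition order_density (m : nat) (x : R) (z : R * R) : R :=
  if [&& (0 <= z.1)%R, (0 <= z.2 < x)%R & (z.2 < 1 - 2 * z.1)%R]
  then (m.+1%:R * z.2 ^+ m)%R else 0%R.

Lemma order_density_ge0 m x z : (0 <= order_density m x z)%R.
Proof.
rewrite /order_density; case: ifPn => // /and3P[_ /andP[z0 _] _].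
by rewrite mulr_ge0// exprn_ge0.
Qed.

Lemma measurable_order_density m x :
  measurable_fun [set: R * R] (order_density m x).
Proof.
apply: measurable_fun_ifT => //.
  apply: measurable_and; first exact: measurable_fun_ler.
  apply: measurable_and; first apply: measurable_and.
  - exact: measurable_fun_ler.
  - exact: measurable_fun_ltr.
  - apply: measurable_fun_ltr => //; apply: measurable_funB => //.
    exact: measurable_funM.
by apply: measurable_funM => //; exact: measurable_funX.
Qed.

(** With z = (b, a), the test together with the bound a < x in [order_density] says that max(0, b -
    s) + a < x. *)
Definition thinned_density m x s (z : R * R) : R :=
  if (z.2 + z.1 - x < s)%R then order_density m x z else 0%R.

Lemma thinned_density_ge0 m x s z : (0 <= thinned_density m x s z)%R.
Proof. by rewrite /thinned_density; case: ifP => // _; exact: order_density_ge0. Qed.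

Lemma measurable_thinned_density m x s :
  measurable_fun [set: R * R] (thinned_density m x s).
Proof.
apply: measurable_fun_ifT => //; last exact: measurable_order_density.
apply: measurable_fun_ltr => //; apply: measurable_funB => //.
exact: measurable_funD.
Qed.

Lemma integral_thinned_density_section m x s (b : R) :
  \int[mu]_a (thinned_density m x s (b, a))%:E =
  (if (0 <= b)%R then
     Num.max 0 (Num.min (1 - b) (x + Num.min b s) - b) ^+ m.+1 else 0)%:E.
Proof.
case: ifPn => b0; last first.
  apply: integral0_eq => a _; rewrite /thinned_density /order_density/=.
  by rewrite (negbTE b0)/=; case: ifP.
rewrite -integral_pow_itv; apply: eq_integral => a _; congr EFin.
rewrite /thinned_density /order_density/= b0/=.
(* Subtracting b inside both minima gives the three bounds 1 - 2b, x and x + s - b on a. *)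
have -> : (a < Num.min (1 - b) (x + Num.min b s) - b)%R =
    [&& (a < 1 - 2 * b)%R, (a < x)%R & (a + b - x < s)%R].
  rewrite ltrBrDr addr_minr !lt_min ltrD2r.
  by congr [&& _, _ & _]; apply/idP/idP => ?; lra.
by case: (0 <= a)%R; case: (a < x)%R; case: (a < 1 - 2 * b)%R; case: ifP.
Qed.

Lemma measurable_comp_affine (x : R) (f : R -> \bar R) : measurable_fun setT f ->
  measurable_fun [set: R * R] (fun z => f (z.2 + z.1 - x)%R).
Proof.
move=> mf; apply: (measurableT_comp mf).
by apply: measurable_funB => //; exact: measurable_funD.
Qed.

Lemma measurable_order_densityM m x (f : R -> \bar R) : measurable_fun setT f ->
  measurable_fun [set: measurableTypeR R * measurableTypeR R]
    (fun z => (order_density m x z)%:E * f (z.2 + z.1 - x)%R).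
Proof.
move=> mf.
have : measurable_fun [set: R * R]
    (fun z => (order_density m x z)%:E * f (z.2 + z.1 - x)%R).
  apply: emeasurable_funM; last exact: measurable_comp_affine.
  by apply/measurable_EFinP; exact: measurable_order_density.
exact.
Qed.

End density.

(** * Expectations under the uniform law *)

Section uniform01_integral.
Local Open Scope ereal_scope.
Context d (T : measurableType d) (R : realType) (P : probability T R).

(* The Borel sets of [R] come with two displays, that of [R] and that of
   [lebesgue_measure]; the identity translates between the two. *)
Lemma ge0_integral_uniform01 (X : {RV P >-> R}) (f : R -> \bar R) :
    uniform01 X -> measurable_fun setT f -> (forall y, 0 <= f y) ->
  \int[P]_w f (X w) = \int[lebesgue_measure]_(y in `[0%R, 1%R]) f y.
Proof.
move=> uX mf f0.
have mid : measurable_fun setT (id : measurableTypeR R -> R).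
  by move=> _ A mA; rewrite setTI.
rewrite -(ge0_integral_distribution X)//.
transitivity
    (\int[pushforward (uniform_prob (@ltr01 R)) (id : measurableTypeR R -> R)]_y
     f y).
  by apply: eq_measure_integral => A mA _; exact: uX.
rewrite ge0_integral_pushforward// preimage_setT.
by rewrite integral_uniform// subr0 invr1 mul1e.
Qed.

End uniform01_integral.

(** * The probability that a given item is nearest and its order is collected in time *)

Section arcs.
Local Open Scope ereal_scope.
Context d (T : measurableType d) (R : realType) (P : probability T R).
Context (m : nat) (V : 'I_m.+2 -> {RV P >-> R}).
Hypotheses (V_indep : mutually_independent V)
  (V_unif : forall i, uniform01 (V i)).
Notation mu := lebesgue_measure.

(* The items other than [i] all lie in an arc following item [i], at distance
   more than [V i] from the origin, and are all collected in time. *)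
Definition collected_arc i (x s : R) : set T :=
  [set w | (0 <= V i w)%R /\ forall j, j != i ->
    [/\ (V i w < V j w)%R, (V j w < 1 - V i w)%R &
        (V j w <= x + Num.min (V i w) s)%R]].

Let arc_section (x s b : R) : set R :=
  [set y | [/\ (b < y)%R, (y < 1 - b)%R & (y <= x + Num.min b s)%R]].

Let measurable_lt d' (T' : measurableType d') (f g : T' -> R) :
  measurable_fun setT f -> measurable_fun setT g ->
  measurable [set w | (f w < g w)%R].
Proof.
move=> mf mg; rewrite -[X in measurable X]setTI.
exact: (measurable_fun_ltr mf mg) measurableT [set true] _.
Qed.

Let measurable_le d' (T' : measurableType d') (f g : T' -> R) :
  measurable_fun setT f -> measurable_fun setT g ->
  measurable [set w | (f w <= g w)%R].
Proof.
move=> mf mg; rewrite -[X in measurable X]setTI.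
exact: (measurable_fun_ler mf mg) measurableT [set true] _.
Qed.

Let measurable_arc_section x s b : measurable (arc_section x s b).
Proof.
rewrite (_ : arc_section x s b =
    [set` `]b, (1 - b)%R[] `&` [set` `]-oo, (x + Num.min b s)%R]]).
  exact: measurableI.
apply/seteqP; split => y /=; rewrite !in_itv/= => -[]; first by move=> -> -> ->.
by move=> /andP[? ?]; split.
Qed.

(** As b >= 0, the arc lies in [0, 1], so its probability is its length. Which bound is active
    decides whether its right end is open or closed, without effect on the length. *)
Let uniform_arc_section x s b : (0 <= b)%R ->
  uniform_prob (@ltr01 R) (arc_section x s b) =
  (Num.max 0 (Num.min (1 - b) (x + Num.min b s) - b))%:E.
Proof.
move=> b0; rewrite /uniform_prob integral_uniform_pdf.
have marc := measurable_arc_section x s b.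
rewrite (_ : _ `&` _ = arc_section x s b); last first.
  apply/setIidPl => y [by_ y1 _] /=; rewrite in_itv/=.
  by rewrite (ltW (le_lt_trans b0 by_))/= (le_trans (ltW y1))// gerBl.
rewrite (eq_integral (fun=> 1)); last first.
  move=> y; rewrite inE => -[by_ y1 _]; rewrite /uniform_pdf.
  by rewrite subr0 invr1 (ltW (le_lt_trans b0 by_))/= (le_trans (ltW y1))// gerBl.
rewrite integral_cst// mul1e.
have [h|h] := leP (1 - b)%R (x + Num.min b s)%R.
  rewrite (_ : arc_section x s b = [set` `]b, (1 - b)%R[]); last first.
    apply/seteqP; split => y /=; rewrite in_itv/=.
      by move=> [-> ->].
    by move=> /andP[? y1]; split => //; rewrite (le_trans (ltW y1)).
  rewrite [LHS]lebesgue_measure_itv/= lte_fin -subr_gt0.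
  by case: ltP => // _; rewrite EFinB.
rewrite (_ : arc_section x s b = [set` `]b, (x + Num.min b s)%R]]); last first.
  apply/seteqP; split => y /=; rewrite in_itv/=.
    by move=> [-> _ ->].
  by move=> /andP[? y1]; split => //; rewrite (le_lt_trans y1).
rewrite [LHS]lebesgue_measure_itv/= lte_fin -subr_gt0.
by case: ltP => // _; rewrite EFinB.
Qed.

Lemma measurable_collected_arc i x s : measurable (collected_arc i x s).
Proof.
rewrite (_ : collected_arc i x s = [set w | (0 <= V i w)%R] `&`
  \bigcap_(j in [set j | j != i])
    ([set w | (V i w < V j w)%R] `&` ([set w | (V j w < 1 - V i w)%R] `&`
     [set w | (V j w <= x + Num.min (V i w) s)%R]))); last first.
  apply/seteqP; split => w [b0 h]; split => // j /= /h.
    by move=> [].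
  by move=> [? []].
apply: measurableI; first exact: measurable_le.
apply: fin_bigcap_measurable => [|j /= ji]; first exact: finite_finset.
apply: measurableI; first exact: measurable_lt.
apply: measurableI; first by apply: measurable_lt => //; exact: measurable_funB.
apply: measurable_le => //; apply: measurable_funD => //.
exact: measurable_minr.
Qed.

(** Given the position b of item [i], the other items fall independently into the same arc, which
    yields a power of its length; that power is the integral of [thinned_density] over a. *)
Lemma prob_collected_arc i x s :
  P (collected_arc i x s) = \int[mu \x mu]_z (thinned_density m x s z)%:E.
Proof.
pose J1 := pred1 i; pose J2 := predC1 i.
(* The event is split over two sample points: item [i] is read at the first, the other items at the
   second. *)
pose E : set (g_sigma_algebraType (cylinders V J1) *
              g_sigma_algebraType (cylinders V J2)) :=
  [set z | (0 <= V i z.1)%R] `&` \bigcap_(j in [set j | j != i])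
    ([set z | (V i z.1 < V j z.2)%R] `&` ([set z | (V j z.2 < 1 - V i z.1)%R] `&`
     [set z | (V j z.2 <= x + Num.min (V i z.1) s)%R])).
have mE : measurable E.
  have mi : measurable_fun [set: g_sigma_algebraType (cylinders V J1) *
              g_sigma_algebraType (cylinders V J2)] (fun z => V i z.1).
    by apply: measurableT_comp => //; apply: measurable_cylinders => /=.
  apply: measurableI; first exact: measurable_le.
  apply: fin_bigcap_measurable => [|j /= ji]; first exact: finite_finset.
  have mj : measurable_fun [set: g_sigma_algebraType (cylinders V J1) *
              g_sigma_algebraType (cylinders V J2)] (fun z => V j z.2).
    by apply: measurableT_comp => //; apply: measurable_cylinders => /=.
  apply: measurableI; first exact: measurable_lt.
  apply: measurableI.
    by apply: measurable_lt => //; exact: measurable_funB.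
  apply: measurable_le => //; apply: measurable_funD => //.
  exact: measurable_minr.
transitivity (P [set w | E (w, w)]).
  congr (P _); apply/seteqP; split => w [].
    by move=> b0 h; split => // j /= /h[].
  by move=> b0 h; split => // j /= /h[? []].
rewrite (cylinders_decoupling V_indep _ mE); last first.
  by move=> j /=; rewrite /J1/=; case: eqP.
pose H b := \int[mu]_a (thinned_density m x s (b, a))%:E.
have mH : measurable_fun setT H.
  apply: (@measurable_fun_fubini_tonelli_F _ _ _ _ R mu
    (fun z => (thinned_density m x s z)%:E)).
    by apply/measurable_EFinP; exact: measurable_thinned_density.
  by move=> z; rewrite lee_fin thinned_density_ge0.
have H0 b : 0 <= H b.
  by apply: integral_ge0 => a _; rewrite lee_fin thinned_density_ge0.
transitivity (\int[P]_w (H (V i w))).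
  apply: eq_integral => w _; rewrite /H integral_thinned_density_section.
  case: ifPn => b0; last first.
    rewrite (_ : [set _ | _] = set0) ?measure0//.
    by apply/seteqP; split => // w' [/=]; rewrite (negbTE b0).
  pose t := [seq j <- enum 'I_m.+2 | j != i].
  rewrite (_ : [set _ | _] =
    \bigcap_(j in [set` t]) (V j @^-1` arc_section x s (V i w))); last first.
    apply/seteqP; split => w' /=.
      by move=> [_ h] j; rewrite /= mem_filter => /andP[/h[? []]].
    move=> h; split => // j /= ji.
    by have := h j; rewrite /= mem_filter ji mem_enum => /(_ isT)[].
  have marc := measurable_arc_section x s (V i w).
  rewrite V_indep//; last by rewrite filter_uniq// enum_uniq.
  under eq_bigr => j _.
    rewrite [P _](V_unif j marc) uniform_arc_section//.
    over.
  (* The exponent is the number of items other than [i]. *)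
  rewrite prodEFin big_const_seq iter_mulr_1 count_predT; congr ((_ ^+ _)%:E).
  have -> : size t = #|predC1 i| by rewrite /t enumT cardE.
  by rewrite cardC1 card_ord.
rewrite (ge0_integral_uniform01 (V_unif i))// fubini_tonelli1//; last 2 first.
- by apply/measurable_EFinP; exact: measurable_thinned_density.
- by move=> z; rewrite lee_fin thinned_density_ge0.
(* The density vanishes for b outside [0, 1], so the integral over [0, 1] coming from the uniform
   law extends to the whole line. *)
have absurd (b a : R) : (0 <= b)%R -> (0 <= a)%R -> (a < 1 - 2 * b)%R ->
  (b < 0)%R \/ (1 < b)%R -> False by move=> ? ? ? []; lra.
rewrite integral_mkcond; apply: eq_integral => b _; rewrite patchE.
case: ifPn => //; rewrite notin_setE/= in_itv/= => /negP.
rewrite negb_and -!ltNge => /orP b01; symmetry; apply: integral0_eq => a _.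
rewrite /thinned_density /order_density/=; case: ifPn => //; case: ifPn => //.
by move=> /and3P[b0 /andP[a0 _] ab]; case: (absurd b a).
Qed.

End arcs.

(** * Invariance of Lebesgue measure under reflections and translations *)

Section reflection.
Local Open Scope ereal_scope.
Context {R : realType}.
Notation mu := (@lebesgue_measure R).

Let reflect (c : R) : measurableTypeR R -> measurableTypeR R := fun y => (c - y)%R.

Let measurable_reflect c : measurable_fun setT (reflect c).
Proof. exact: (@measurable_funB _ R R setT (cst c) id). Qed.

(** By uniqueness of Lebesgue measure it suffices to treat half-open intervals; the reflection only
    moves the open end to the other side. *)
Let lebesgue_measure_reflection c (A : set R) : measurable A ->
  pushforward mu (reflect c) A = mu A.
Proof.
move=> mA; apply/esym/lebesgue_measure_unique => //= _ [[a b]] _ <-.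
rewrite /pushforward (_ : _ @^-1` _ = [set` `[(c - b)%R, (c - a)%R[]).
  rewrite !lebesgue_measure_itv/= !lte_fin ltrD2l ltrN2.
  by case: ifPn => // _; rewrite -!EFinB; congr EFin; ring.
by apply/seteqP; split => y /=; rewrite !in_itv/= /reflect => /andP[? ?];
  apply/andP; split; lra.
Qed.

Lemma ge0_integral_reflection (c : R) (f : R -> \bar R) :
    measurable_fun setT f -> (forall y, 0 <= f y) ->
  \int[mu]_y f (c - y)%R = \int[mu]_y f y.
Proof.
move=> mf f0; transitivity (\int[pushforward mu (reflect c)]_y f y).
  by rewrite ge0_integral_pushforward// preimage_setT.
by apply: eq_measure_integral => A mA _; exact: lebesgue_measure_reflection.
Qed.

Lemma ge0_integral_translation (c : R) (f : R -> \bar R) :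
    measurable_fun setT f -> (forall y, 0 <= f y) ->
  \int[mu]_y f (c + y)%R = \int[mu]_y f y.
Proof.
move=> mf f0.
have mf' : measurable_fun setT (fun y : R => f (c - y)%R).
  by apply: measurableT_comp => //; exact: measurable_funB.
(* A translation is a composition of two reflections. *)
transitivity (\int[mu]_y f (c - (0 - y))%R).
  by apply: eq_integral => y _; congr f; ring.
rewrite -(ge0_integral_reflection c mf f0).
exact: (ge0_integral_reflection 0 mf' (fun y => f0 _)).
Qed.

End reflection.

(** * Distances in a chosen direction as random variables *)

Section travel_rv.
Context d (T : measurableType d) (R : realType) (P : probability T R).

Lemma measurable_travel d' (T' : measurableType d') ccw (X : T' -> R) :
  measurable_fun setT X -> measurable_fun setT (fun w => travel ccw (X w)).
Proof. by move=> mX; case: ccw => //=; exact: measurable_funB. Qed.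

Definition travel_rv ccw (X : {RV P >-> R}) : {RV P >-> R} :=
  mfun_Sub (mem_set (measurable_travel ccw (measurable_funPT X))).

(** The reflection y -> 1 - y preserves both Lebesgue measure and [0, 1], so the clockwise and
    counterclockwise cases become symmetric. *)
Lemma uniform01_travel ccw X : uniform01 X -> uniform01 (travel_rv ccw X).
Proof.
move=> uX D mD; case: ccw; last exact: uX.
have mD' : measurable ((fun y : R => 1 - y) @^-1` D).
  rewrite -[X in measurable X]setTI.
  exact: (@measurable_funB _ R R setT (cst 1) id).
transitivity (distribution P X ((fun y : R => 1 - y) @^-1` D)) => //.
rewrite uX// /uniform_prob integral_mkcond [RHS]integral_mkcond.
rewrite -[RHS](@ge0_integral_reflection _ 1%R).
- apply: eq_integral => y _; rewrite !patchE.
  rewrite (_ : (1 - y \in D) = (y \in (fun y : R => 1 - y) @^-1` D)); last first.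
    by apply/idP/idP; rewrite !inE.
  case: ifPn => // _; rewrite /uniform_pdf subr0 subr_ge0 gerBl andbC.
  by [].
- apply/(measurable_restrictT _ mD)/measurable_EFinP/measurable_funTS.
  exact: measurable_uniform_pdf.
- by move=> y; rewrite patchE; case: ifPn => // _; rewrite lee_fin uniform_pdf_ge0.
Qed.

Lemma mutually_independent_travel (I : eqType) ccw (X : I -> {RV P >-> R}) :
  mutually_independent X -> mutually_independent (travel_rv ccw \o X).
Proof.
move=> iX s D us mD.
pose D' i := travel ccw @^-1` D i.
have mD' i : measurable (D' i).
  by rewrite -[X in measurable X]setTI; exact: measurable_travel.
exact: iX s D' us mD'.
Qed.

End travel_rv.

(** * Deterministic analysis of an order without ties *)

Section nearest_item.
Context {R : realType} {m : nat}.
Implicit Types (p : 'I_m.+2 -> R) (i j : 'I_m.+2) (ccw : bool).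

(** The two strict bounds say that every other item is farther than item [i] in both directions. *)
Definition is_nearest ccw i p : Prop :=
  0 <= travel ccw (p i) /\ forall j, j != i ->
    travel ccw (p i) < travel ccw (p j) < 1 - travel ccw (p i).

Lemma travelN ccw (x : R) : travel (~~ ccw) x = 1 - travel ccw x.
Proof. by case: ccw => //=; ring. Qed.

Lemma exists_other i : exists j, j != i.
Proof.
have [->|i0] := eqVneq i ord0; first by exists (lift ord0 ord0).
by exists ord0; rewrite eq_sym.
Qed.

(** A second item lies strictly between d and 1 - d, where d is the distance of the nearest one, so
    d < 1 - d. *)
Lemma is_nearest_lt_half ccw i p : is_nearest ccw i p -> travel ccw (p i) < 1 / 2.
Proof. by move=> [_]; have [j ji] := exists_other i => /(_ j ji) /andP[]; lra. Qed.

Lemma first_item_nearest ccw i p :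
  is_nearest ccw i p -> first_item ccw p = travel ccw (p i).
Proof.
move=> h; have := is_nearest_lt_half h; case: h => b0 h b2.
apply/eqP; rewrite eq_le bigmin_le/= le_bigmin//; first by lra.
by move=> j _; have [->//|/h/andP[/ltW]] := eqVneq j i.
Qed.

Lemma first_item_farthest ccw i p :
  is_nearest ccw i p -> travel ccw (p i) < first_item (~~ ccw) p.
Proof.
move=> h; have := is_nearest_lt_half h; case: h => b0 h b2.
rewrite lt_bigmin//; first by lra.
move=> j _; rewrite travelN; have [->|/h/andP[_]] := eqVneq j i; lra.
Qed.

Lemma prep_time_nearest ccw i p :
  is_nearest ccw i p -> prep_time p = travel ccw (p i).
Proof.
move=> h; rewrite /prep_time bigmin_split.
have := first_item_farthest h; have := first_item_nearest h.
rewrite /first_item; case: ccw {h} => /= -> h.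
  by rewrite minC min_l// ltW.
by rewrite min_l// ltW.
Qed.

Lemma nearest_ccw_nearest ccw i p :
  is_nearest ccw i p -> nearest_ccw p = ccw.
Proof.
move=> h; rewrite /nearest_ccw.
have := first_item_farthest h; have := first_item_nearest h.
by case: ccw {h} => /= -> // h; apply/negbTE; rewrite -leNgt ltW.
Qed.

(** The direction is determined by [nearest_ccw]; two distinct items at the same minimal distance
    would contradict strictness. *)
Lemma is_nearest_inj ccw i ccw' i' p :
  is_nearest ccw i p -> is_nearest ccw' i' p -> (ccw, i) = (ccw', i').
Proof.
move=> h h'; have cc : ccw = ccw'.
  by rewrite -(nearest_ccw_nearest h) (nearest_ccw_nearest h').
move: h'; rewrite -cc => h'; congr pair; apply/eqP/negP => /negP ii'.
have := prep_time_nearest h; rewrite (prep_time_nearest h') => e.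
by have [_ /(_ _ ii')] := h'; rewrite e ltxx.
Qed.

Lemma pick_time_nearest ccw i p (x s : R) : is_nearest ccw i p ->
  Num.max 0 (prep_time p - s) + pick_time p <= x <->
  forall j, j != i ->
    travel ccw (p j) <= x + Num.min (travel ccw (p i)) s.
Proof.
move=> h; rewrite /pick_time (nearest_ccw_nearest h) (prep_time_nearest h).
rewrite (first_item_nearest h); case: h => b0 h; set b := travel ccw (p i).
(* Uses max(0, b - s) - b = - min(b, s). *)
have -> : (Num.max 0 (b - s) + (last_item ccw p - b) <= x) =
    (last_item ccw p <= x + Num.min b s).
  by apply/idP/idP; case: (leP 0 (b - s)) => ?; case: (leP b s) => ?; lra.
split => [/bigmax_leP[_ hx] j _|hx]; first exact: hx.
(* A second item [j] settles both the default value 0 of the maximum and item [i] itself: 0 <= b <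
   travel of [j] <= bound. *)
have [j ji] := exists_other i.
have /andP[bj _] := h j ji; have xj := hx j ji.
apply/bigmax_leP; split; first exact: ltW (le_lt_trans b0 (lt_le_trans bj xj)).
move=> k _; have [->|/hx//] := eqVneq k i.
exact: ltW (lt_le_trans bj xj).
Qed.

End nearest_item.

(** * Iterated integrals against the order density *)

Section order_density_integral.
Local Open Scope ereal_scope.
Context {R : realType}.
Notation mu := (@lebesgue_measure R).

Lemma integral_order_densityM m (x : R) (g : R * R -> \bar R) :
    measurable_fun setT g -> (forall z, 0 <= g z) ->
  \int[mu \x mu]_z ((order_density m x z)%:E * g z) =
  m.+1%:R%:E * \int[mu]_(a in `[0%R, x]) ((a ^+ m)%:E *
    \int[mu]_(b in `[0%R, ((1 - a) / 2)%R[) g (b, a)).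
Proof.
move=> mg g0.
have mf' y : measurable_fun setT (fun z => (order_density m y z)%:E * g z).
  apply: emeasurable_funM => //; apply/measurable_EFinP.
  exact: measurable_order_density.
have mf y : measurable_fun [set: measurableTypeR R * measurableTypeR R]
    (fun z => (order_density m y z)%:E * g z) by exact: mf'.
have f0 y z : 0 <= (order_density m y z)%:E * g z.
  by rewrite mule_ge0// lee_fin order_density_ge0.
(* The cutoff x + 1 exceeds every a in the closed interval [0, x], so the right end can be closed
   without changing the form of the integrand there. *)
pose G a := \int[mu]_b ((order_density m (x + 1) (b, a))%:E * g (b, a)).
have mG : measurable_fun setT G.
  exact: (@measurable_fun_fubini_tonelli_G _ _ _ _ R mu _ (mf _) (f0 _)).
have half (b a : R) : (a < 1 - 2 * b)%R = (b < (1 - a) / 2)%R.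
  by apply/idP/idP => ?; lra.
have -> : \int[mu \x mu]_z ((order_density m x z)%:E * g z) =
    \int[mu]_(a in `[0%R, x[) G a.
  rewrite (fubini_tonelli2 _ (mf x) (f0 x)).
  rewrite [RHS]integral_mkcond.
  apply: eq_integral => a _.
  rewrite patchE mem_setE in_itv/=; case: ifPn => a0x.
    apply: eq_integral => b _; rewrite /order_density/= a0x.
    have -> : (0 <= a < x + 1)%R by case/andP : a0x => ? ?; apply/andP; lra.
    by [].
  apply: integral0_eq => b _; rewrite /order_density/= (negbTE a0x)/= andbF.
  by rewrite mul0e.
rewrite integral_itv_bndo_bndc; last exact: measurable_funTS.
have G0 a : 0 <= G a by exact: integral_ge0.
have m0 : m.+1%:R != 0%R :> R by rewrite pnatr_eq0.
transitivity (\int[mu]_(a in `[0%R, x]) (m.+1%:R%:E * (m.+1%:R^-1%:E * G a))).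
  by apply: eq_integral => a _; rewrite muleA -EFinM divff// mul1e.
rewrite ge0_integralZl//; last 2 first.
- by apply: measurable_funTS; exact: emeasurable_funM.
- by move=> a _; rewrite mule_ge0.
congr (_ * _).
apply: eq_integral => a; rewrite inE/= in_itv/= => /andP[a0 ax].
rewrite -[LHS]ge0_integralZl//; last first.
  exact: (measurableT_comp (mf _) (measurable_fun_pair _ _)).
rewrite -[RHS]ge0_integralZl//; last 2 first.
- by apply: measurable_funTS; exact: measurableT_comp.
- by rewrite lee_fin exprn_ge0.
rewrite [RHS]integral_mkcond; apply: eq_integral => b _.
rewrite patchE mem_setE in_itv/= /order_density/= a0/=.
have -> : (a < x + 1)%R by lra.
rewrite half.
by case: ifPn => _; rewrite ?mul0e ?mule0// muleA -EFinM mulKf.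
Qed.

(** Times 2n, with n = m + 2, this is n x^(n-1) - (n-1) x^n, the distribution function of A. *)
Lemma integral_order_density m (x : R) : (0 <= x <= 1)%R ->
  \int[mu \x mu]_z (order_density m x z)%:E =
  ((x ^+ m.+1 - m.+1%:R / m.+2%:R * x ^+ m.+2) / 2)%:E.
Proof.
move=> /andP[x0 x1].
transitivity (\int[mu \x mu]_z ((order_density m x z)%:E * 1)).
  by apply: eq_integral => z _; rewrite mule1.
rewrite (@integral_order_densityM m x (cst 1))//.
transitivity (m.+1%:R%:E * \int[mu]_(a in `[0%R, x])
    (a ^+ m * ((1 - a) / 2))%:E).
  congr (_ * _).
  apply: eq_integral => a; rewrite inE/= in_itv/= => /andP[a0 ax].
  rewrite integral_cst// mul1e.
  transitivity ((a ^+ m)%:E * ((1 - a) / 2)%:E) => //; congr (_ * _).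
  rewrite [LHS]lebesgue_measure_itv/= lte_fin sube0; case: ltP => // h.
  by congr EFin; lra.
pose E k := @GRing.exp R ^~ k.
(* A primitive of a^m (1 - a) / 2. *)
pose F : R -> R :=
  (2^-1 *: (m.+1%:R^-1 *: E m.+1 - m.+2%:R^-1 *: E m.+2))%R.
have FE a : F a = ((a ^+ m.+1 / m.+1%:R - a ^+ m.+2 / m.+2%:R) / 2)%R.
  by rewrite [RHS]mulrC (mulrC (a ^+ m.+1)%R) (mulrC (a ^+ m.+2)%R).
have dE k (a : R) : is_derive a 1%R (E k.+1) (k.+1%:R * a ^+ k)%R.
  apply: DeriveDef; first exact: exprn_derivable.
  by rewrite -derive1E exp_derive1.
have dF (a : R) : is_derive a 1%R F (a ^+ m * ((1 - a) / 2))%R.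
  have := is_deriveZ 2^-1 (is_deriveB
    (is_deriveZ m.+1%:R^-1 (dE m a)) (is_deriveZ m.+2%:R^-1 (dE m.+1 a))).
  move/is_derive_eq; apply; rewrite /GRing.scale/= exprS.
  by field; rewrite nat1r -natrD !pnatr_eq0.
have [x00|xn0] := eqVneq x 0%R.
  rewrite x00 set_itv1 integral_set1 mule0; congr EFin.
  by rewrite !expr0n/= mulr0 subr0 mul0r.
have xgt0 : (0 < x)%R by rewrite lt_neqAle eq_sym xn0.
have cF : continuous F.
  move=> a; apply: differentiable_continuous; apply/derivable1_diffP.
  by case: (dF a).
rewrite (@continuous_FTC2 _ _ F)//.
- rewrite !FE !expr0n/= !mul0r subr0 mul0r sube0 -EFinM; congr EFin.
  by field; rewrite nat1r -natrD !pnatr_eq0.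
- apply: continuous_subspaceT => a; apply: cvgM.
    exact: exprn_continuous.
  apply: cvgM; last exact: cvg_cst.
  by apply: cvgB; [exact: cvg_cst|exact: cvg_id].
- split.
  + by move=> a _; case: (dF a).
  + by apply: cvg_at_right_filter; exact: cF.
  + by apply: cvg_at_left_filter; exact: cF.
- by move=> a _; rewrite derive1E; case: (dF a).
Qed.

End order_density_integral.

(** * Measurability of preparation and pick times *)

Section measurable_order.
Context d (T : measurableType d) (R : realType) (n : nat).
Context (p : 'I_n -> T -> R).
Hypothesis mp : forall i, measurable_fun setT (p i).

Lemma measurable_bigmin (I : Type) (r : seq I) (c : R) (f : I -> T -> R) :
  (forall i, measurable_fun setT (f i)) ->
  measurable_fun setT (fun w => \big[Num.min/c]_(i <- r) f i w).
Proof.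
move=> mf; elim: r => [|i r ih].
  by under eq_fun do rewrite big_nil; exact: measurable_cst.
under eq_fun do rewrite big_cons.
by apply: measurable_minr.
Qed.

Lemma measurable_bigmax (I : Type) (r : seq I) (c : R) (f : I -> T -> R) :
  (forall i, measurable_fun setT (f i)) ->
  measurable_fun setT (fun w => \big[Num.max/c]_(i <- r) f i w).
Proof.
move=> mf; elim: r => [|i r ih].
  by under eq_fun do rewrite big_nil; exact: measurable_cst.
under eq_fun do rewrite big_cons.
by apply: measurable_maxr.
Qed.

Lemma measurable_first_item ccw :
  measurable_fun setT (fun w => first_item ccw (fun i => p i w)).
Proof. by apply: measurable_bigmin => i; exact: measurable_travel. Qed.

Lemma measurable_last_item ccw :
  measurable_fun setT (fun w => last_item ccw (fun i => p i w)).
Proof. by apply: measurable_bigmax => i; exact: measurable_travel. Qed.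

Lemma measurable_prep_time :
  measurable_fun setT (fun w => prep_time (fun i => p i w)).
Proof.
apply: measurable_bigmin => i.
by apply: measurable_minr; exact: (measurable_travel _ (mp i)).
Qed.

Lemma measurable_pick_time :
  measurable_fun setT (fun w => pick_time (fun i => p i w)).
Proof.
rewrite (_ : (fun w => _) = (fun w =>
  if first_item true (p^~ w) < first_item false (p^~ w)
  then last_item true (p^~ w) - first_item true (p^~ w)
  else last_item false (p^~ w) - first_item false (p^~ w))); last first.
  by apply/funext => w; rewrite /pick_time /nearest_ccw; case: ifP.
apply: measurable_fun_ifT.
- by apply: measurable_fun_ltr; exact: measurable_first_item.
- by apply: measurable_funB;
    [exact: measurable_last_item|exact: measurable_first_item].
- by apply: measurable_funB;
    [exact: measurable_last_item|exact: measurable_first_item].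
Qed.

End measurable_order.

(** * The law of max(0, B - s) + A for a fixed s *)

Section order_law.
Local Open Scope ereal_scope.
Context d (T : measurableType d) (R : realType) (P : probability T R).
Notation mu := (@lebesgue_measure R).

Lemma measure_bigcup_finType (I : finType) (F : I -> set T) (c : \bar R) :
    trivIset setT F -> (forall i, measurable (F i)) ->
    (forall i, P (F i) = c) ->
  P (\bigcup_i F i) = #|I|%:R%:E * c.
Proof.
move=> tF mF Fc.
rewrite (_ : [set: I] = [set` enum I]); last first.
  by apply/seteqP; split => i //= _; rewrite mem_enum.
rewrite measure_fin_bigcup//; last exact: sub_trivIset tF.
transitivity (\sum_(i <- enum I) c).
  by rewrite -fsbig_seq ?enum_uniq//; apply: eq_bigr => i _; exact: Fc.
rewrite big_const_seq count_predT -cardE.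
by rewrite iter_addr_0 mule_natl.
Qed.

Context (m : nat) (X : 'I_m.+2 -> {RV P >-> R}).
Hypotheses (X_indep : mutually_independent X)
  (X_unif : forall i, uniform01 (X i)).

Let arc_ (x s : R) (k : bool * 'I_m.+2) : set T :=
  collected_arc (travel_rv k.1 \o X) k.2 x s.

Let measurable_arc_ x s k : measurable (arc_ x s k).
Proof. exact: measurable_collected_arc. Qed.

Let arc_nearest x s k w :
  arc_ x s k w -> is_nearest k.1 k.2 (fun i => X i w).
Proof.
by move=> [b0 h]; split => // j /h[? ? _]; apply/andP.
Qed.

Let trivIset_arc x s : trivIset setT (arc_ x s).
Proof.
apply/trivIsetP => -[e i] [e' i'] _ _ /eqP ne.
apply/seteqP; split => // w [/arc_nearest h /arc_nearest h'].
by apply: ne; exact: is_nearest_inj h h'.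
Qed.

Let prob_bigcup_arc x s : P (\bigcup_k arc_ x s k) =
  (2 * m.+2%:R)%:E * \int[mu \x mu]_z (thinned_density m x s z)%:E.
Proof.
rewrite (@measure_bigcup_finType _ _
  (\int[mu \x mu]_z (thinned_density m x s z)%:E) (@trivIset_arc x s)).
- by rewrite card_prod card_bool card_ord natrM.
- by move=> k; exact: measurable_arc_.
move=> k; apply: prob_collected_arc => [|i]; first exact: mutually_independent_travel.
exact: uniform01_travel.
Qed.

(* An item is almost surely nearest: the [2 * m.+2] disjoint events that a given
   item is nearest in a given direction have total probability 1. *)
Let prob_bigcup_nearest : P (\bigcup_k arc_ 1 1 k) = 1.
Proof.
rewrite prob_bigcup_arc.
(* At x = s = 1 thinning removes nothing: a < 1 - 2b with b >= 0 implies a + b < 2. *)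
have -> : \int[mu \x mu]_z (thinned_density m 1 1 z)%:E =
    \int[mu \x mu]_z (order_density m 1 z)%:E.
  apply: eq_integral => z _; rewrite /thinned_density; case: ifPn => //.
  rewrite /order_density; case: ifPn => // /and3P[? /andP[? ?] ?].
  by move=> /negP h; exfalso; apply: h; lra.
rewrite integral_order_density ?ler01 ?lexx// !expr1n -EFinM; congr EFin.
by field; rewrite -natrD pnatr_eq0.
Qed.

(** The union of the arc events lies in [Q], and contains [Q] on the event [N] that some item is
    nearest, which has probability 1. *)
Lemma order_law (x s : R) :
  P [set w | (Num.max 0 (prep_time (fun i => X i w) - s) +
              pick_time (fun i => X i w) <= x)%R] =
  (2 * m.+2%:R)%:E * \int[mu \x mu]_z (thinned_density m x s z)%:E.
Proof.
rewrite -prob_bigcup_arc.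
set Q := [set w | _]; set N := \bigcup_k arc_ 1 1 k.
have mbig y t : measurable (\bigcup_k arc_ y t k).
  by apply: fin_bigcup_measurable => // k _; exact: measurable_arc_.
have mQ : measurable Q.
  rewrite -[X in measurable X]setTI.
  apply: (measurable_fun_ler _ _ measurableT (Y := [set true])) => //.
  apply: measurable_funD.
    apply: measurable_maxr => //; apply: measurable_funB => //.
    exact: measurable_prep_time.
  exact: measurable_pick_time.
have NQ : Q `&` N `<=` \bigcup_k arc_ x s k.
  move=> w [Qw [[e i] _ Nw]]; exists (e, i) => //.
  have h := arc_nearest Nw; have /= hx := (pick_time_nearest x s h).1 Qw.
  case: Nw => b0 Nw; split => // j ji; have [? ? _] := Nw j ji.
  by split => //; exact: hx.
have QN : \bigcup_k arc_ x s k `<=` Q.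
  move=> w [[e i] _ Aw]; apply/(pick_time_nearest x s (arc_nearest Aw)).
  by case: Aw => b0 Aw j /Aw[].
apply/eqP; rewrite eq_le; apply/andP; split; last first.
  by apply: le_measure => //; rewrite inE.
have -> : P Q = P (Q `&` N).
  rewrite (measureDI P mQ (mbig 1%R 1%R)) [X in X + _](_ : _ = 0) ?add0e//.
  apply/eqP; rewrite eq_le measure_ge0 andbT.
  have <- : P (~` N) = 0.
    rewrite (probability_setC P (mbig 1%R 1%R)) prob_bigcup_nearest.
    by rewrite subee.
  apply: le_measure; rewrite ?inE.
  - by apply: measurableD => //; exact: mbig.
  - by apply: measurableC; exact: mbig.
  - by move=> w [].
by apply: le_measure => //; rewrite inE//; apply: measurableI => //; exact: mbig.
Qed.

End order_law.

(** * Continuity of the distribution function of a variable with a density *)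

Section continuity.
Context d (T : measurableType d) (R : realType) (P : probability T R).

Lemma has_density_cdf_continuous (X : {RV P >-> R}) :
  has_density X -> continuous (cdf X).
Proof.
move=> [f [mf f0 fX]] t.
have X0 r : distribution P X [set r] = 0%E by rewrite fX// integral_set1.
have mN : measurable_fun setT (fun w => - X w) by exact: measurable_funN.
pose NX : {RV P >-> R} := mfun_Sub (mem_set mN).
apply/left_right_continuousP; split; last exact: cdf_right_continuous.
apply/cvg_at_leftNP.
(* Points are null, so P(X <= -r) = P(X < -r) = P(-X > r); left continuity for X becomes right
   continuity for -X. *)
have cdfN : cdf X \o -%R =1 ccdf NX.
  move=> r; rewrite /cdf /ccdf /=.
  transitivity (distribution P X `]-oo, (- r)[).
    rewrite -(@setUitv1 _ _ -oo%O (- r) true)// [LHS]measureU0//; exact: X0.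
  congr (P _); apply/seteqP; split => w /=; rewrite !in_itv/= ?andbT; lra.
rewrite (eq_cvg _ _ cdfN).
have -> : cdf X t = ccdf NX (- t) by rewrite -cdfN /= opprK.
exact: ccdf_right_continuous.
Qed.

End continuity.

(** * One step of the sojourn time recursion *)

Section sojourn.
Local Open Scope ereal_scope.
Context d (T : measurableType d) (R : realType) (P : probability T R).
Context (m : nat) (pos : nat -> 'I_m.+2 -> {RV P >-> R}).
Hypotheses (pos_unif : forall k i, uniform01 (pos k i))
  (pos_indep : mutually_independent (fun ki : nat * 'I_m.+2 => pos ki.1 ki.2)).
Context (S_ : nat -> {RV P >-> R}) (S_sojourn : sojourn_process pos S_).
Notation mu := (@lebesgue_measure R).
Let X (ki : nat * 'I_m.+2) := pos ki.1 ki.2.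

(** The recursion makes [S_ k] a function of the orders 0 to k. Its measurability for that smaller
    sigma-algebra is what makes it independent of order k + 1. *)
Let measurable_sojourn k (J : pred (nat * 'I_m.+2)) :
  (forall ki, (ki.1 <= k)%N -> J ki) ->
  measurable_fun [set: g_sigma_algebraType (cylinders X J)] (S_ k).
Proof.
elim: k => [|k ih] kJ.
  have mp i : measurable_fun [set: g_sigma_algebraType (cylinders X J)] (pos 0%N i).
    by apply: (@measurable_cylinders _ _ _ P _ X J (0%N, i)); exact: kJ.
  rewrite (_ : (S_ 0%N : T -> R) = (fun w => prep_time (fun i => pos 0%N i w) +
    pick_time (fun i => pos 0%N i w))%R); last first.
    by apply/funext => w; rewrite S_sojourn.1.
  by apply: measurable_funD; [exact: measurable_prep_time|exact: measurable_pick_time].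
have mp i : measurable_fun [set: g_sigma_algebraType (cylinders X J)] (pos k.+1 i).
  by apply: (@measurable_cylinders _ _ _ P _ X J (k.+1, i)); exact: kJ.
rewrite (_ : (S_ k.+1 : T -> R) = (fun w =>
  Num.max 0 (prep_time (fun i => pos k.+1 i w) - S_ k w) +
  pick_time (fun i => pos k.+1 i w))%R); last first.
  by apply/funext => w; rewrite S_sojourn.2.
apply: measurable_funD; last exact: measurable_pick_time.
apply: measurable_maxr => //; apply: measurable_funB.
  exact: measurable_prep_time.
by apply: ih => ki ki_k; apply: kJ; exact: leqW.
Qed.

(** Decoupling past orders from order k + 1 freezes s = [S_ k w], and [order_law] applies to the
    fresh positions. *)
Let sojourn_mixture k x : cdf (S_ k.+1) x =
  \int[P]_w ((2 * m.+2%:R)%:E *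
    \int[mu \x mu]_z (thinned_density m x (S_ k w) z)%:E).
Proof.
pose J1 (ki : nat * 'I_m.+2) := (ki.1 <= k)%N.
pose J2 (ki : nat * 'I_m.+2) := (ki.1 == k.+1)%N.
pose E : set (g_sigma_algebraType (cylinders X J1) *
              g_sigma_algebraType (cylinders X J2)) :=
  [set ww | (Num.max 0 (prep_time (fun i => pos k.+1 i ww.2) - S_ k ww.1) +
             pick_time (fun i => pos k.+1 i ww.2) <= x)%R].
have mE : measurable E.
  have mp i : measurable_fun [set: g_sigma_algebraType (cylinders X J1) *
              g_sigma_algebraType (cylinders X J2)] (fun z => pos k.+1 i z.2).
    apply: measurableT_comp => //.
    by apply: (@measurable_cylinders _ _ _ P _ X J2 (k.+1, i)); exact: eqxx.
  rewrite -[X in measurable X]setTI.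
  apply: (measurable_fun_ler _ _ measurableT (Y := [set true])) => //.
  apply: measurable_funD; last exact: measurable_pick_time.
  apply: measurable_maxr => //; apply: measurable_funB.
    exact: measurable_prep_time.
  exact: (measurableT_comp
    (@measurable_sojourn k J1 (fun ki h => h)) measurable_fst).
transitivity (P [set w | E (w, w)]).
  by congr (P _); apply/seteqP; split => w /=; rewrite in_itv/= S_sojourn.2.
rewrite (cylinders_decoupling pos_indep _ mE); last first.
  by move=> ki; rewrite /J1 /J2; case: eqP => [->|]; rewrite ?ltnn ?andbF.
have iX : mutually_independent (pos k.+1).
  move=> s D us mD.
  have := pos_indep (s := [seq (k.+1, i) | i <- s]) (D := fun ki => D ki.2).
  rewrite big_map => <- //.
  - congr (P _); apply/seteqP; split => w' h.
      by move=> _ /= /mapP[i si ->]; exact: h.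
    by move=> i si; apply: (h (k.+1, i)); apply/mapP; exists i.
  - by rewrite map_inj_uniq// => i j [].
apply: eq_integral => w _.
by rewrite -(order_law iX (pos_unif k.+1)).
Qed.

(** Only the thinning test depends on [S_ k]; it averages to P(S_k > a + b - x). *)
Lemma integral_thinned_density k x z :
  \int[P]_w (thinned_density m x (S_ k w) z)%:E =
  (order_density m x z)%:E * ccdf (S_ k) (z.2 + z.1 - x)%R.
Proof.
pose late := S_ k @^-1` `](z.2 + z.1 - x)%R, +oo[.
have mlate : measurable late by exact: measurable_funPTI.
transitivity (\int[P]_w ((order_density m x z)%:E * (\1_late w)%:E)).
  apply: eq_integral => w _; rewrite /thinned_density indicE.
  rewrite (_ : (w \in late) = (z.2 + z.1 - x < S_ k w)%R); last first.
    by apply/idP/idP; rewrite inE /late/= in_itv/= andbT.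
  by case: ifPn => _; rewrite ?mule1 ?mule0.
rewrite ge0_integralZl//.
- by rewrite integral_indic// setIT.
- exact/measurable_EFinP.
- by rewrite lee_fin order_density_ge0.
Qed.

Lemma sojourn_step k x : cdf (S_ k.+1) x = (2 * m.+2%:R)%:E *
  \int[mu \x mu]_z ((order_density m x z)%:E * ccdf (S_ k) (z.2 + z.1 - x)%R).
Proof.
rewrite sojourn_mixture.
pose f w z := (thinned_density m x (S_ k w) z)%:E.
have f0 w z : 0 <= f w z by rewrite lee_fin thinned_density_ge0.
have m11 : measurable_fun [set: (T * R) * R] (fun u => u.1.1).
  exact: (measurableT_comp measurable_fst measurable_fst).
have m12 : measurable_fun [set: (T * R) * R] (fun u => u.1.2).
  exact: (measurableT_comp measurable_snd measurable_fst).
have mf : measurable_fun [set: (T * R) * R] (fun u => f u.1.1 (u.1.2, u.2)).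
  apply/measurable_EFinP; apply: measurable_fun_ifT => //.
    apply: measurable_fun_ltr.
      apply: measurable_funB; last exact: measurable_cst.
      apply: measurable_funD; first exact: measurable_snd.
      exact: m12.
    exact: (measurableT_comp (measurable_funPT (S_ k)) m11).
  apply: (measurableT_comp (measurable_order_density m x)).
  by apply: measurable_fun_pair; [exact: m12|exact: measurable_snd].
have mfz w : measurable_fun [set: measurableTypeR R * measurableTypeR R] (f w).
  have : measurable_fun [set: R * R] (f w).
    by apply/measurable_EFinP; exact: measurable_thinned_density.
  exact.
(* The sample point is exchanged with the pair (b, a) one coordinate at a time: first with b,
   through [F], then with a. *)
pose F (u : T * measurableTypeR R) := \int[mu]_a f u.1 (u.2, a).
have mF : measurable_fun setT F.
  exact: (@measurable_fun_fubini_tonelli_F _ _ _ _ R mu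
    (fun u : (T * measurableTypeR R) * measurableTypeR R =>
       f u.1.1 (u.1.2, u.2)) mf (fun u => f0 _ _)).
have F0 u : 0 <= F u by exact: integral_ge0.
have fF w : \int[mu \x mu]_z f w z = \int[mu]_b F (w, b).
  by rewrite (fubini_tonelli1 _ (mfz w) (f0 w)).
under eq_integral do rewrite -/(f _) fF.
rewrite ge0_integralZl//; last 2 first.
- exact: (@measurable_fun_fubini_tonelli_F _ _ _ _ R mu F mF F0).
- by move=> w _; exact: integral_ge0.
congr (_ * _).
rewrite (@fubini_tonelli _ _ _ _ R P mu F mF F0).
pose g (z : measurableTypeR R * measurableTypeR R) :=
  (order_density m x z)%:E * ccdf (S_ k) (z.2 + z.1 - x)%R.
have mg := measurable_order_densityM m x (ccdf_measurable (S_ k)).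
have g0 z : 0 <= g z by rewrite mule_ge0// lee_fin order_density_ge0.
rewrite (fubini_tonelli1 g mg g0); apply: eq_integral => b _.
have mfb : measurable_fun [set: T * measurableTypeR R] (fun u => f u.1 (b, u.2)).
  have : measurable_fun [set: T * R] (fun u => f u.1 (b, u.2)).
    have mb : measurable_fun [set: T * R] (fun u => ((u.1, b), u.2)).
      by apply: measurable_fun_pair => //; exact: measurable_fun_pair.
    exact: (measurableT_comp mf mb).
  exact.
rewrite /F/= (@fubini_tonelli _ _ _ _ R P mu _ mfb (fun u => f0 _ _)).
apply: eq_integral => a _ /=.
exact: (@integral_thinned_density k x (b, a)).
Qed.

End sojourn.

(** * Passage to the limiting distribution *)

Section stationary.
Local Open Scope ereal_scope.
Context d (T : measurableType d) (R : realType) (P : probability T R).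
Context (m : nat) (pos : nat -> 'I_m.+2 -> {RV P >-> R}).
Hypotheses (pos_unif : forall k i, uniform01 (pos k i))
  (pos_indep : mutually_independent (fun ki : nat * 'I_m.+2 => pos ki.1 ki.2)).
Context (S_ : nat -> {RV P >-> R}) (S_sojourn : sojourn_process pos S_).
Context d' (T' : measurableType d') (P' : probability T' R) (S : {RV P' >-> R}).
Hypotheses (S_lim : cvg_in_distribution S_ S) (S_cont : continuous (cdf S)).
Notation mu := (@lebesgue_measure R).

Let ccdf_S_cvg t : ccdf (S_ k) t @[k --> \oo] --> ccdf S t.
Proof.
rewrite ccdf_1_cdf; under eq_cvg do rewrite ccdf_1_cdf.
apply: cvgeB; first by rewrite fin_num_adde_defr.
- exact: cvg_cst.
- exact: (S_lim (@S_cont t)).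
Qed.

Lemma integrable_order_density x : (0 <= x <= 1)%R ->
  (mu \x mu).-integrable setT (fun z => (order_density m x z)%:E).
Proof.
move=> x01; apply/integrableP; split.
  have : measurable_fun [set: R * R] (fun z => (order_density m x z)%:E).
    by apply/measurable_EFinP; exact: measurable_order_density.
  exact.
under eq_integral do rewrite gee0_abs ?lee_fin ?order_density_ge0//.
by rewrite integral_order_density// ltry.
Qed.

(** Both sides of [sojourn_step] converge: the left as a shifted sequence, the right by domination
    by [order_density], since tail probabilities are at most 1. *)
Lemma stationary_ccdf x : (0 <= x <= 1)%R ->
  cdf S x = (2 * m.+2%:R)%:E *
    \int[mu \x mu]_z ((order_density m x z)%:E * ccdf S (z.2 + z.1 - x)%R).
Proof.
move=> x01.
pose g (X : R -> \bar R) (z : measurableTypeR R * measurableTypeR R) :=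
  (order_density m x z)%:E * X (z.2 + z.1 - x)%R.
have cvgL : cdf (S_ k.+1) x @[k --> \oo] --> cdf S x.
  by rewrite (cvg_shiftS (fun k => cdf (S_ k) x)); exact: (S_lim (@S_cont x)).
apply: (cvg_unique _ cvgL) => //.
rewrite /= (eq_cvg _ _ (fun k => sojourn_step pos_unif pos_indep S_sojourn k x)).
apply: cvgeZl => //.
apply: (@dominated_cvg _ _ _ (mu \x mu) setT measurableT
  (fun k => g (ccdf (S_ k))) (g (ccdf S)) (fun z => (order_density m x z)%:E)).
- by move=> k; exact: (measurable_order_densityM m x (ccdf_measurable _)).
- move=> z _; apply: cvgeZl => //; exact: ccdf_S_cvg.
- by [].
- exact: integrable_order_density.
- move=> k z _; rewrite gee0_abs; last first.
    by rewrite mule_ge0// lee_fin order_density_ge0.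
  rewrite -[leRHS]mule1 lee_wpmul2l ?lee_fin ?order_density_ge0//.
  exact: probability_le1.
Qed.

Lemma stationary_cdf x : (0 <= x <= 1)%R ->
  cdf S x = (m.+2%:R * x ^+ m.+1 - m.+1%:R * x ^+ m.+2)%:E -
    (2 * m.+2%:R * m.+1%:R)%:E * \int[mu]_(a in `[0%R, x]) ((a ^+ m)%:E *
      \int[mu]_(b in `[0%R, ((1 - a) / 2)%R[) cdf S (a + b - x)%R).
Proof.
move=> x01.
pose C := \int[mu \x mu]_z ((order_density m x z)%:E * cdf S (z.2 + z.1 - x)%R).
pose D := \int[mu \x mu]_z ((order_density m x z)%:E * ccdf S (z.2 + z.1 - x)%R).
have mC := measurable_order_densityM m x (cdf_measurable S).
have mD := measurable_order_densityM m x (ccdf_measurable S).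
have C0 : 0 <= C.
  by apply: integral_ge0 => z _; rewrite mule_ge0// lee_fin order_density_ge0.
have D0 : 0 <= D.
  by apply: integral_ge0 => z _; rewrite mule_ge0// lee_fin order_density_ge0.
have CD : D + C = ((x ^+ m.+1 - m.+1%:R / m.+2%:R * x ^+ m.+2) / 2)%:E.
  rewrite -integral_order_density// /D /C -ge0_integralD//.
  - apply: eq_integral => z _.
    by rewrite -ge0_muleDr// ccdf_cdf_1 mule1.
  - by move=> z _; rewrite mule_ge0// lee_fin order_density_ge0.
  - by move=> z _; rewrite mule_ge0// lee_fin order_density_ge0.
(* [C] and [D] add up to a finite total mass; finiteness of [C] permits subtracting it in the
   extended reals. *)
have Cfin : C \is a fin_num.
  rewrite ge0_fin_numE// (@le_lt_trans _ _ (D + C))//; first exact: leeDr.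
  by rewrite CD ltry.
have DE : D = ((x ^+ m.+1 - m.+1%:R / m.+2%:R * x ^+ m.+2) / 2)%:E - C.
  by rewrite -CD addeK.
rewrite stationary_ccdf// -/D DE muleBr//.
congr (_ - _).
  by rewrite -EFinM; congr EFin; field; rewrite -natrD pnatr_eq0.
have mF := measurable_comp_affine x (cdf_measurable S).
rewrite /C (integral_order_densityM m x mF)// muleA -EFinM.
by [].
Qed.

End stationary.

(** * Integrals of the distribution function and their change of variable *)

Section dist_fun_integral.
Local Open Scope ereal_scope.
Context d (T : measurableType d) (R : realType) (P : probability T R).
Context (S : {RV P >-> R}).
Notation mu := (@lebesgue_measure R).

Lemma EFin_dist_fun x : (dist_fun S x)%:E = cdf S x.
Proof. by rewrite fineK// fin_num_measure. Qed.

Lemma EFin_Rintegral_dist_fun (u : R) :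
  (\int[mu]_(z in `[0%R, u]) dist_fun S z)%R%:E = \int[mu]_(z in `[0%R, u]) cdf S z.
Proof.
rewrite /Rintegral; under eq_integral do rewrite EFin_dist_fun.
rewrite fineK// ge0_fin_numE; last exact: integral_ge0.
apply: (@le_lt_trans _ _ (\int[mu]_(z in `[0%R, u]) 1)).
  apply: ge0_le_integral => //.
  - exact: (measurable_funTS (cdf_measurable S)).
  - by move=> z _; exact: cdf_le1.
rewrite integral_cst// mul1e [ltLHS]lebesgue_measure_itv/=.
by case: ifP => _; rewrite -?EFinB ltry.
Qed.

Lemma cdf_le0 z : dist_fun S 0 = 0%R -> (z <= 0)%R -> cdf S z = 0.
Proof.
move=> S0 z0; apply/eqP; rewrite eq_le cdf_ge0 andbT.
by rewrite -[leRHS]/(0%:E) -S0 EFin_dist_fun; exact: cdf_nondecreasing.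
Qed.

(** Substituting z = a + b - x maps the range of b onto [a - x, u[. As a <= x, this starts at or
    below 0, and the part below 0 contributes nothing because the distribution function vanishes
    there. *)
Lemma integral_cdf_shift (a x : R) : dist_fun S 0 = 0%R -> (a <= x)%R ->
  \int[mu]_(b in `[0%R, ((1 - a) / 2)%R[) cdf S (a + b - x)%R =
  \int[mu]_(z in `[0%R, (1 / 2 + a / 2 - x)%R]) cdf S z.
Proof.
move=> S0 ax; set u := (1 / 2 + a / 2 - x)%R.
pose F : R -> \bar R := (cdf S) \_ `[(a - x)%R, u[.
have mF : measurable_fun setT F.
  apply/(measurable_restrictT _ (measurable_itv _)).
  exact: measurable_funTS (cdf_measurable S).
have F0 y : 0 <= F y by rewrite /F patchE; case: ifP.
transitivity (\int[mu]_b F (a - x + b)%R).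
  rewrite integral_mkcond; apply: eq_integral => b _.
  rewrite /F !patchE !mem_setE !in_itv/= (_ : (a - x + b = a + b - x)%R)//; last by ring.
  rewrite (_ : (_ <= a + b - x < u)%R = (0 <= b < (1 - a) / 2)%R)//.
  by rewrite /u; apply/idP/idP => /andP[? ?]; apply/andP; split; lra.
rewrite ge0_integral_translation// -integral_itv_bndo_bndc; last first.
  exact: measurable_funTS (cdf_measurable S).
rewrite [RHS]integral_mkcond; apply: eq_integral => z _.
rewrite /F !patchE !mem_setE !in_itv/=.
have [z0|z0] := leP 0%R z.
  by rewrite (le_trans _ z0)// subr_le0.
by case: ifP => // _; rewrite cdf_le0// ltW.
Qed.

End dist_fun_integral.

(** * The integral equation in real-valued form *)

Theorem lemma1 (R : realType) (n : nat) (hn : (2 <= n)%N)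
  (d : measure_display) (T : measurableType d) (P : probability T R)
  (pos : nat -> 'I_n -> {RV P >-> R})
  (pos_unif : forall k i, uniform01 (pos k i))
  (pos_indep : mutually_independent (fun ki : nat * 'I_n => pos ki.1 ki.2))
  (S_ : nat -> {RV P >-> R}) (S_sojourn : sojourn_process pos S_)
  (d' : measure_display) (T' : measurableType d') (P' : probability T' R)
  (S : {RV P' >-> R}) (S_lim : cvg_in_distribution S_ S)
  (S_01 : {ae P', forall w, 0 <= S w <= 1})
  (S_0 : dist_fun S 0 = 0) (S_dens : has_density S)
  (x : R) (hx : 0 <= x <= 1) :
  dist_fun S x =
    n%:R * x ^+ (n - 1) - (n%:R - 1) * x ^+ n
    - 2 * n%:R * (n%:R - 1) *
      \int[lebesgue_measure]_(y in `[Num.max 0 (2 * x - 1), x])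
        (y ^+ (n - 2) *
         \int[lebesgue_measure]_(z in `[0, 1 / 2 + y / 2 - x]) dist_fun S z).
Proof.
move: hx => /andP[x0 x1]; have x01 : 0 <= x <= 1 by rewrite x0.
case: n hn pos pos_unif pos_indep S_sojourn => [//|[//|m]] _ pos pos_unif
  pos_indep S_sojourn.
rewrite !subn1 !subn2 /= (_ : (m.+2%:R - 1 = m.+1%:R :> R)); last first.
  by rewrite -[m.+2%:R]natr1 addrK.
have S_cont := has_density_cdf_continuous S_dens.
have := stationary_cdf pos_unif pos_indep S_sojourn S_lim S_cont x01.
set J := (\int[_]_(a in _) _)%E => SJ.
(* For a < 2x - 1 the upper limit 1/2 + a/2 - x is negative and the inner integral vanishes, so the
   outer one may start at max(0, 2x - 1). *)
rewrite [Rintegral _ _ _](_ : _ = fine J); last first.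
  congr fine; rewrite /J integral_mkcond [RHS]integral_mkcond.
  apply: eq_integral => a _; rewrite !patchE !mem_setE !in_itv/= ge_max.
  have [ax|ax] := leP a x; last by rewrite !andbF.
  rewrite !andbT; have [a0|//] := leP 0 a.
  rewrite integral_cdf_shift//.
  have [h|h] := leP (2 * x - 1) a; first by rewrite EFinM EFin_Rintegral_dist_fun.
  by rewrite set_itv_ge ?integral_set0 ?mule0// bnd_simp -ltNge; lra.
have c0 : 0 < 2 * m.+2%:R * m.+1%:R :> R by rewrite !mulr_gt0.
(* An infinite [J] with its positive coefficient would make the right-hand side infinite, whereas a
   probability is finite. *)
have : cdf S x \is a fin_num by rewrite fin_num_measure.
rewrite {1}SJ /dist_fun SJ; case: J {SJ} => [r _//||].
- by rewrite gt0_muley ?lte_fin.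
- by rewrite gt0_muleNy ?lte_fin.
Qed.
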